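(* Let $n\ge2$, let $A_n$ be the free associative algebra on $x_1,\dots,x_n$, let $B_m=B_m(A_n)$, and let $m\geq 2$. (1) For all $n$, $$B_2=\sum_i[x_i,B_1].$$ (2) For $n\geq 4$, $$B_{m+1}= \sum_{i}[x_i,B_m]+\sum_{i\leq j}[x_ix_j,B_m]+\sum_{i<j<k}[x_i[x_j,x_k],B_m].$$ (3) For $n=3$, $$B_{m+1}=\sum_i[x_i,B_m]+\sum_{i \leq j}[x_ix_j,B_m].$$ (4) For $n=2$, $$B_{m+1}= \sum_i[x_i,B_m]+\sum_{i < j}[x_ix_j,B_m].$$ All indices run over $\{1,\dots,n\}$.
   Context: The ground field is $\mathbb{C}$ (or any field of characteristic zero in its place). $A=A_n$ is the free unital associative algebra on $x_1,\ldots,x_n$. For subspaces $P,Q$, $[P,Q]$ is the span of commutators $[p,q]=pq-qp$. Put $L_1=A$, $L_{m+1}=[A,L_m]$, $B_m=L_m/L_{m+1}$; $\bigoplus_{m\ge1} B_m$ is a graded Lie algebra with bracket $B_i\times B_j\to B_{i+j}$ induced by the commutator. For $a\in A$, $[a,B_m]\subset B_{m+1}$ denotes $\{[\bar a,b]: b\in B_m\}$, where $\bar a$ is the class of $a$ in $B_1=A/[A,A]$. *)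

(* Defs.v *)
From HB Require Import structures.
From mathcomp Require Import all_boot all_algebra.
From mathcomp Require Import boolp classical_sets.
From mathcomp Require Import finmap.
From mathcomp Require Import monalg.

Set Implicit Arguments.
Unset Strict Implicit.
Unset Printing Implicit Defensive.

Import GRing.Theory.
Local Open Scope classical_set_scope.
Local Open Scope quotient_scope.
Local Open Scope ring_scope.

Section Subspaces.
Variables (F : fieldType) (V : lmodType F).
Implicit Types S : set V.

Definition span S : set V :=
  [set v | exists r : seq (F * V),
     (forall p, p \in r -> S p.2) /\ v = \sum_(p <- r) p.1 *: p.2].

Lemma sub_span S : S `<=` span S.
Proof.
move=> v Sv; exists [:: (1, v)]; split; last by rewrite big_seq1 scale1r.
by move=> p; rewrite inE => /eqP ->.
Qed.

Lemma span0 S : span S 0.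
Proof. by exists [::]; rewrite big_nil. Qed.

Lemma spanD S u v : span S u -> span S v -> span S (u + v).
Proof.
move=> [r [rS ->]] [s [sS ->]]; exists (r ++ s); rewrite big_cat; split=> // p.
by rewrite mem_cat => /orP[/rS|/sS].
Qed.

Lemma spanZ S a u : span S u -> span S (a *: u).
Proof.
move=> [r [rS ->]]; exists [seq (a * p.1, p.2) | p <- r]; split.
  by move=> _ /mapP[p /rS Sp ->].
by rewrite big_map scaler_sumr; apply: eq_bigr => p _; rewrite scalerA.
Qed.

Lemma span_ind S (P : set V) : P 0 -> (forall u v, P u -> P v -> P (u + v)) ->
  (forall a u, P u -> P (a *: u)) -> S `<=` P -> span S `<=` P.
Proof.
move=> P0 PD PZ SP _ [r [rS ->]]; rewrite big_seq; apply: big_ind => // p pr.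
exact/PZ/SP/rS.
Qed.

End Subspaces.

Section SetSum.
Variable V : zmodType.
Implicit Types S T U : set V.

(* On subspaces this is the usual sum of subspaces, with neutral element the
   zero subspace [set 0]. *)
Definition addset S T : set V := [set s + t | s in S & t in T].

Lemma addsetA : associative addset.
Proof.
move=> S T U; apply/seteqP; split=> v.
  move=> [s Ss [_ [t Tt [u Uu <-]] <-]].
  by exists (s + t); [exists s => //; exists t | exists u; rewrite ?addrA].
move=> [_ [s Ss [t Tt <-]] [u Uu <-]].
by exists s => //; exists (t + u); [exists t => //; exists u | rewrite addrA].
Qed.

Lemma addsetC : commutative addset.
Proof.
by move=> S T; apply/seteqP; split=> v [s Ss [t Tt <-]];
  exists t => //; exists s; rewrite // addrC.
Qed.

Lemma add0set : left_id [set 0] addset.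
Proof.
move=> S; apply/seteqP; split=> v; first by move=> [_ -> [t St <-]]; rewrite add0r.
by move=> Sv; exists 0 => //; exists v; rewrite ?add0r.
Qed.

HB.instance Definition _ :=
  Monoid.isComLaw.Build (set V) [set 0] addset addsetA addsetC add0set.

End SetSum.

Arguments addset {V} S T.

Section LowerCentralSeries.
Variables (F : fieldType) (A : algType F).

Definition lie (p q : A) : A := p * q - q * p.

Lemma lieDl p p' q : lie (p + p') q = lie p q + lie p' q.
Proof. by rewrite /lie mulrDl mulrDr opprD addrACA. Qed.

Lemma lieDr p q q' : lie p (q + q') = lie p q + lie p q'.
Proof. by rewrite /lie mulrDl mulrDr opprD addrACA. Qed.

Lemma lieZl a p q : lie (a *: p) q = a *: lie p q.
Proof. by rewrite /lie scalerBr -scalerAl -scalerAr. Qed.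

Lemma lieZr a p q : lie p (a *: q) = a *: lie p q.
Proof. by rewrite /lie scalerBr -scalerAl -scalerAr. Qed.

Lemma lieBl p p' q : lie (p - p') q = lie p q - lie p' q.
Proof. by rewrite lieDl -scaleN1r lieZl scaleN1r. Qed.

Lemma lieBr p q q' : lie p (q - q') = lie p q - lie p q'.
Proof. by rewrite lieDr -scaleN1r lieZr scaleN1r. Qed.

Lemma lie0l q : lie 0 q = 0.
Proof. by rewrite /lie mul0r mulr0 subrr. Qed.

Lemma lie_lie a l b : lie (lie a l) b = lie a (lie l b) - lie l (lie a b).
Proof.
rewrite /lie !(mulrBl, mulrBr) !mulrA !opprB.
by rewrite [RHS]addrACA !subrKA addrACA [- _ - _]addrC addrACA.
Qed.

Definition comm_space (P Q : set A) : set A :=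
  span [set lie p q | p in P & q in Q].

(* The series starts at L 1 = A; L 0 = A is only a convention. *)
Fixpoint L (m : nat) : set A :=
  if m is k.+1 then if k is 0 then setT else comm_space setT (L k) else setT.

Lemma L1 : L 1 = setT. Proof. by []. Qed.

Lemma LS m : L m.+2 = comm_space setT (L m.+1). Proof. by []. Qed.

Lemma L_0 m : L m 0.
Proof. by case: m => [|[|m]] //; exact: span0. Qed.

Lemma L_D m u v : L m u -> L m v -> L m (u + v).
Proof. by case: m => [|[|m]] //; exact: spanD. Qed.

Lemma L_Z m a u : L m u -> L m (a *: u).
Proof. by case: m => [|[|m]] //; exact: spanZ. Qed.

Lemma L_B m u v : L m u -> L m v -> L m (u - v).
Proof. by move=> Lu Lv; apply: L_D => //; rewrite -scaleN1r; exact: L_Z. Qed.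

Lemma lie_LS m a u : L m u -> L m.+1 (lie a u).
Proof. by case: m => // m Lu; apply: sub_span; exists a => //; exists u. Qed.

Lemma LS_sub m : L m.+1 `<=` L m.
Proof.
elim: m => [//|[//|m] IHm]; rewrite LS; apply: span_ind.
- exact: L_0.
- exact: L_D.
- exact: L_Z.
- by move=> _ [a _ [u /IHm Lu <-]]; exact: lie_LS.
Qed.

Lemma lie_L i j u v : L i u -> L j v -> L (i + j) (lie u v).
Proof.
case: i => [_ /(lie_LS u)/LS_sub //|i]; elim: i => [|i IHi] in j u v *.
  by move=> _ /(lie_LS u).
rewrite LS => Lu Lv; move: u Lu; apply: span_ind.
- by rewrite lie0l; exact: L_0.
- by move=> u u' ? ?; rewrite lieDl; exact: L_D.
- by move=> a u ?; rewrite lieZl; exact: L_Z.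
move=> _ [a _ [u Lu <-]]; rewrite lie_lie; apply: L_B.
  by rewrite addSn; apply/lie_LS/IHi.
by rewrite addSnnS; apply: IHi => //; exact: lie_LS.
Qed.

Definition Lpred m : {pred A} := fun a => `[< L m a >].

Lemma LpredP m a : reflect (L m a) (a \in Lpred m).
Proof. exact: asboolP. Qed.

Lemma Lpred_submod m : submod_closed (Lpred m).
Proof.
split; first exact/LpredP/L_0.
move=> a u v /LpredP Lu /LpredP Lv; apply/LpredP.
by apply: L_D => //; exact: L_Z.
Qed.

HB.instance Definition _ m :=
  GRing.isSubmodClosed.Build F A (Lpred m) (Lpred_submod m).

Record Lspace m := InL { Lval :> A; Lval_in : Lval \in Lpred m }.

HB.instance Definition _ m := [isSub for @Lval m].
HB.instance Definition _ m := [Choice of Lspace m by <:].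
HB.instance Definition _ m := [SubChoice_isSubLmodule of Lspace m by <:].

(* L m.+1, contained in L m by LS_sub, as a subspace of L m. *)
Definition Lnext m : {pred Lspace m} := fun u => val u \in Lpred m.+1.

Lemma in_Lnext m (u : Lspace m) : (u \in @Lnext m) = (val u \in Lpred m.+1).
Proof. by []. Qed.

Lemma Lnext_submod m : submod_closed (@Lnext m).
Proof.
split=> [|a u v]; rewrite !in_Lnext ?raddf0 ?rpred0 //.
by rewrite linearP => Lu Lv; rewrite rpredD ?rpredZ.
Qed.

HB.instance Definition _ m :=
  GRing.isSubmodClosed.Build F (Lspace m) (@Lnext m) (@Lnext_submod m).

Definition B m := {ideal_quot (@Lnext m)}.

HB.instance Definition _ m := GRing.Zmodule.on (B m).
HB.instance Definition _ m := EqQuotient.on (B m).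

Definition cls m (u : Lspace m) : B m := \pi u.

Lemma cls_repr m (x : B m) : cls (repr x) = x.
Proof. exact: reprK. Qed.

Lemma clsP m (u v : Lspace m) : cls u = cls v <-> L m.+1 (val u - val v).
Proof.
rewrite -raddfB; split=> [/eqP|/LpredP].
  by rewrite -Quotient.idealrBE => /LpredP.
by move=> Luv; apply/eqP; rewrite -Quotient.idealrBE.
Qed.

Lemma cls_is_zmod_morphism m : zmod_morphism (@cls m).
Proof. by move=> u v; rewrite /cls !piE. Qed.

HB.instance Definition _ m :=
  GRing.isZmodMorphism.Build (Lspace m) (B m) (@cls m) (@cls_is_zmod_morphism m).

Definition Bscale m (a : F) (x : B m) : B m := cls (a *: repr x).

Lemma Bscale_cls m a (u : Lspace m) : Bscale a (cls u) = cls (a *: u).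
Proof.
apply/clsP; have valZ v : val (a *: v) = a *: val v by exact: linearZ.
by rewrite !valZ -scalerBr; apply/L_Z/clsP; exact: cls_repr.
Qed.

Lemma BscaleA m a b (x : B m) : Bscale a (Bscale b x) = Bscale (a * b) x.
Proof. by rewrite -[x]cls_repr !Bscale_cls scalerA. Qed.

Lemma Bscale1 m : left_id 1 (@Bscale m).
Proof. by move=> x; rewrite -[x]cls_repr Bscale_cls scale1r. Qed.

Lemma BscaleDr m : right_distributive (@Bscale m) +%R.
Proof.
move=> a x y; rewrite -[x]cls_repr -[y]cls_repr -raddfD !Bscale_cls -raddfD.
by rewrite scalerDr.
Qed.

Lemma BscaleDl m (x : B m) : {morph (@Bscale m)^~ x : a b / a + b}.
Proof. by move=> a b; rewrite -[x]cls_repr !Bscale_cls -raddfD scalerDl. Qed.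

HB.instance Definition _ m := GRing.Zmodule_isLmodule.Build F (B m)
  (@BscaleA m) (@Bscale1 m) (@BscaleDr m) (@BscaleDl m).

Lemma cls_is_scalable m : scalable (@cls m).
Proof. by move=> a u; rewrite -Bscale_cls. Qed.

HB.instance Definition _ m :=
  GRing.isScalable.Build F (Lspace m) (B m) *:%R (@cls m) (@cls_is_scalable m).

Definition Llie i j (u : Lspace i) (v : Lspace j) : Lspace (i + j) :=
  InL (introT (LpredP _ _)
         (lie_L (elimT (LpredP i u) (Lval_in u)) (elimT (LpredP j v) (Lval_in v)))).

(* The bracket B i x B j -> B (i + j); it is computed on representatives, and
   does not depend on them by Blie_cls. *)
Definition Blie i j (x : B i) (y : B j) : B (i + j) :=
  cls (Llie (repr x) (repr y)).

Lemma Blie_cls i j (u : Lspace i) (v : Lspace j) :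
  Blie (cls u) (cls v) = cls (Llie u v).
Proof.
set u' := repr (cls u); set v' := repr (cls v).
have /clsP Lu : cls u' = cls u by exact: cls_repr.
have /clsP Lv : cls v' = cls v by exact: cls_repr.
apply/clsP; rewrite [_ - _](_ : _ =
  lie (val u' - val u) (val v') + lie (val u) (val v' - val v)).
  apply: L_D; first by rewrite -addSn; apply: lie_L => //; exact/LpredP/Lval_in.
  by rewrite -addnS; apply: lie_L => //; exact/LpredP/Lval_in.
by rewrite lieBl lieBr subrKA.
Qed.

Definition bar (a : A) : B 1 := cls (InL (introT (LpredP 1 a) I)).

(* [a, B m] as a subset of B m.+1; note that 1 + m is convertible to m.+1. *)
Definition brB (a : A) (m : nat) : set (B m.+1) :=
  [set (Blie (bar a) b : B m.+1) | b in [set: B m]].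

End LowerCentralSeries.

Arguments brB {F A} a m.

(* The monoid algebra of the free monoid on x_1, ..., x_n, indexed by 'I_n. *)
Definition freeAlg (F : fieldType) (n : nat) := {malg F[{fmonom 'I_n}]}.

Section FreeAlgebra.
Variables (F : fieldType) (n : nat).

HB.instance Definition _ := GRing.Lalgebra.on (freeAlg F n).

Lemma freeAlg_scaleAr (a : F) (p q : freeAlg F n) : a *: (p * q) = p * (a *: q).
Proof.
apply/malgP => k; rewrite mcoeffZ (mcoeffMlw k (fsubset_refl _) (fsubset_refl _)).
rewrite (mcoeffMlw k (fsubset_refl _) (msuppZ_le a q)) mulr_sumr.
apply: eq_bigr => k1 _; rewrite mulr_sumr; apply: eq_bigr => k2 _.
by rewrite mcoeffZ mulrCA mulrnAr.
Qed.

HB.instance Definition _ :=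
  GRing.Lalgebra_isAlgebra.Build F (freeAlg F n) freeAlg_scaleAr.

Definition gen (i : 'I_n) : freeAlg F n := << fmu i >>.

End FreeAlgebra.

Arguments gen F {n} i.
Arguments B {F} A m.

(* Main.v *)
(* Fix m >= 2 and a subspace P containing L (m + 2), and let T be the space of
   those f with [f, L m] in P; it contains L 2 = [A, A].  The key point is that
   a^2 L m is contained in L m + a L m for every a, so that
   [a^3, L m] lies in [a, L m] + [a^2, L m].  Polarizing, a b c + a c b is in T
   as soon as a, b, c, a b, a c, b c are.  Applied to words, this shows that T
   contains every word as soon as it contains the words of length at most 2 and
   the elements x_i [x_j, x_k].  The latter alternate in i, j, k modulo [A, A],
   which leaves i < j < k.  For n = 3, x_1 [x_2, x_3] is central in the graded Lie
   algebra because [a [b, c], d] alternates modulo L 3; for n = 2, the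
   squares x_i^2 are dealt with by expanding [x_i^3, [x_j, l]] in two ways. *)
From Stdlib Require Import Ncring Ncring_tac.
Require Import Defs.
From mathcomp Require Import all_boot all_algebra.
From mathcomp Require Import boolp classical_sets.
From mathcomp Require Import monalg zify.

Set Implicit Arguments.
Unset Strict Implicit.
Unset Printing Implicit Defensive.

Import GRing.Theory.
Local Open Scope classical_set_scope.
Local Open Scope ring_scope.

(** * Subspaces and finite sums of subspaces *)

Section Subspace.
Variables (F : fieldType) (V : lmodType F).
Implicit Types S T : set V.

Definition subspace S := S 0 /\ forall c u v, S u -> S v -> S (c *: u + v).

Lemma subspace0 S : subspace S -> S 0. Proof. by case. Qed.

Lemma subspaceD S u v : subspace S -> S u -> S v -> S (u + v).
Proof. by move=> [_ Slin] Su Sv; rewrite -[u]scale1r; exact: Slin. Qed.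

Lemma subspaceZ S c u : subspace S -> S u -> S (c *: u).
Proof. by move=> [S0 Slin] Su; rewrite -[_ *: _]addr0; exact: Slin. Qed.

Lemma subspaceN S u : subspace S -> S u -> S (- u).
Proof. by move=> Ss Su; rewrite -scaleN1r; exact: subspaceZ. Qed.

Lemma subspaceB S u v : subspace S -> S u -> S v -> S (u - v).
Proof. by move=> Ss Su Sv; apply: subspaceD => //; exact: subspaceN. Qed.

Lemma subspaceMn S u k : subspace S -> S u -> S (u *+ k).
Proof. by move=> Ss Su; rewrite -scaler_nat; exact: subspaceZ. Qed.

(** Every use of characteristic zero passes through this division. *)
Lemma subspace_divn S u k : [pchar F] =i pred0 -> subspace S ->
  S (u *+ k.+1) -> S u.
Proof.
move=> /pcharf0P charF0 Ss Su; have k_neq0 : k.+1%:R != 0 :> F by rewrite charF0.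
by rewrite -[u](scalerK k_neq0) scaler_nat; exact: subspaceZ.
Qed.

Lemma span_sub_subspace S T : subspace T -> S `<=` T -> Defs.span S `<=` T.
Proof.
by move=> Ts ST; apply: span_ind => //; [exact: subspace0
  | move=> *; exact: subspaceD | move=> *; exact: subspaceZ].
Qed.

Lemma subspace_set0 : subspace [set 0].
Proof. by split=> // c u v -> ->; rewrite scaler0 addr0. Qed.

Lemma subspace_addset S T : subspace S -> subspace T -> subspace (addset S T).
Proof.
move=> [S0 Slin] [T0 Tlin]; split; first by exists 0 => //; exists 0; rewrite ?addr0.
move=> c _ _ [s Ss [t Tt <-]] [s' Ss' [t' Tt' <-]].
exists (c *: s + s'); first exact: Slin.
by exists (c *: t + t'); [exact: Tlin | rewrite scalerDr addrACA].
Qed.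

Lemma sub_addsetl S T : subspace T -> S `<=` addset S T.
Proof. by move=> [T0 _] s Ss; exists s => //; exists 0; rewrite ?addr0. Qed.

Lemma sub_addsetr S T : subspace S -> T `<=` addset S T.
Proof. by rewrite addsetC; exact: sub_addsetl. Qed.

Lemma subspace_bigaddset (I : finType) (P : pred I) (S : I -> set V) :
  (forall i, subspace (S i)) -> subspace (\big[addset/[set 0]]_(i | P i) S i).
Proof.
move=> Ss; apply: (big_ind subspace) => [|S1 S2|//]; first exact: subspace_set0.
exact: subspace_addset.
Qed.

Lemma sub_bigaddset (I : finType) (P : pred I) (S : I -> set V) i :
  (forall i, subspace (S i)) -> P i ->
  S i `<=` \big[addset/[set 0]]_(j | P j) S j.
Proof.
move=> Ss Pi; rewrite (bigD1 i) //=; apply: sub_addsetl.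
exact: subspace_bigaddset.
Qed.

Lemma sub_bigaddset2 (I J : finType) (P : I -> pred J) (S : I -> J -> set V) i j :
  (forall i j, subspace (S i j)) -> P i j -> S i j `<=`
  \big[addset/[set 0]]_i \big[addset/[set 0]]_(j | P i j) S i j.
Proof.
move=> Ss Pij; apply: subset_trans (sub_bigaddset (Ss i) Pij) _.
apply: (sub_bigaddset (S := fun i => \big[addset/[set 0]]_(j | P i j) S i j)) => // k.
exact: subspace_bigaddset.
Qed.

End Subspace.

(** * Words in a family of elements *)

Section Word.
Variables (F : fieldType) (A : algType F) (n : nat) (g : 'I_n -> A).

Definition word (s : seq 'I_n) : A := \prod_(i <- s) g i.

Lemma word_cat s t : word (s ++ t) = word s * word t.
Proof. exact: big_cat. Qed.

Lemma word_cons i s : word (i :: s) = g i * word s.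
Proof. exact: big_cons. Qed.

Lemma word1 i : word [:: i] = g i.
Proof. exact: big_seq1. Qed.

Lemma word2 i j : word [:: i; j] = g i * g j.
Proof. by rewrite word_cons word1. Qed.

(** Spanning is encoded as an induction principle over subspaces, the form in which it is
    applied. *)
Definition words_span := forall T : set A,
  subspace T -> (forall s, T (word s)) -> forall u, T u.

End Word.

(** * Commutator identities and the spaces [L m] *)

Section LowerCentral.
Variables (F : fieldType) (A : algType F).
Hypothesis charF0 : [pchar F] =i pred0.
Implicit Types (P T : set A) (a b c d l u v : A).

#[local] Instance Aops :
  @Ring_ops A 0 1 +%R *%R (fun x y => x - y) -%R eq := {}.

#[local] Instance Aring : Ring (Ro := Aops).
Proof.
split; [exact: eq_equivalence | by move=> x y -> u v -> | by move=> x y -> u v ->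
  | by move=> x y -> u v -> | by move=> x y -> | exact: add0r | exact: addrC
  | exact: addrA | exact: mul1r | exact: mulr1 | exact: mulrA | exact: mulrDl
  | by move=> x y z; exact: mulrDr | by [] | exact: subrr].
Qed.

Ltac ncring := rewrite /lie ?(mulrSr, mulr0n); non_commutative_ring.

Lemma lie0r u : lie u 0 = 0. Proof. by ncring. Qed.

Lemma lieC u v : lie u v = - lie v u. Proof. by ncring. Qed.

Lemma subspace_L m : subspace (@L F A m).
Proof.
split=> [|c u v Lu Lv]; first exact: L_0.
by apply: L_D => //; apply: L_Z.
Qed.

Lemma L_sub_lie m T : subspace T -> (forall a l, L m.+1 l -> T (lie a l)) ->
  L m.+2 `<=` T.
Proof.
by move=> Ts Tlie; apply: span_sub_subspace => // _ [a _ [l Ll <-]]; exact: Tlie.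
Qed.

Lemma L2_lie u v : L 2 (lie u v). Proof. exact: lie_LS. Qed.

Lemma L3_lie_l a u : L 2 u -> L 3 (lie u a).
Proof.
move=> Lu; rewrite lieC; apply: subspaceN; last exact: lie_LS.
exact: subspace_L.
Qed.

Lemma subspace_lie P a : subspace P -> subspace [set l | P (lie a l)].
Proof.
move=> Ps; split=> [|c u v /= Pu Pv]; first by rewrite /= lie0r; exact: subspace0.
by rewrite lieDr lieZr; apply: subspaceD => //; exact: subspaceZ.
Qed.

(* Stops at lie u v, which a plain apply of subspaceD would unfold into a sum. *)
Ltac lincomb Ss := repeat match goal with
  | |- _ (_ + _) => apply: (subspaceD Ss)
  | |- _ (- _) => apply: (subspaceN Ss)
  | |- _ (_ *+ _) => apply: (subspaceMn _ Ss)
  end.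

(** * Elements whose bracket sends [L m] into a given subspace *)

Definition carries P m : set A := [set f | forall l, L m l -> P (lie f l)].

Lemma subspace_carries P m : subspace P -> subspace (carries P m).
Proof.
move=> Ps; split=> [l _|c u v cu cv l Ll]; first by rewrite lie0l; exact: subspace0.
rewrite lieDl lieZl; apply: subspaceD; [by [] | | exact: cv].
by apply: subspaceZ => //; exact: cu.
Qed.

Lemma carries_L2 P m : L m.+2 `<=` P -> L 2 `<=` carries P m.
Proof. by move=> LP u Lu l Ll; apply/LP/(lie_L Lu Ll). Qed.

Lemma carries_full P m : subspace P -> (forall a, carries P m.+1 a) ->
  L m.+2 `<=` P.
Proof.
by move=> Ps cP; apply: L_sub_lie => // a l; exact: cP.
Qed.

(** * Reduction to words of length at most 2 and the elements x_i [x_j, x_k] *)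

Lemma mul_swap T a b : subspace T -> L 2 `<=` T -> T (a * b) -> T (b * a).
Proof.
move=> Ts L2T Tab; rewrite (_ : b * a = a * b - lie a b); last by ncring.
by apply: subspaceB => //; exact/L2T/L2_lie.
Qed.

(* The polarization of the fact that [a^3, L m] lies in [a, L m] + [a^2, L m]
   for m >= 2.  The latter follows from a^2 [b, l] = l0 + a l1, with
   l0 = - [a^2 b, l] - [a b, [a, l]] and l1 = 2 [a b, l] + [b, [a, l]] in L m:
   left multiplication by a maps L m + a L m to itself. *)
Lemma carries_mul3 P m a c d : subspace P -> L m.+4 `<=` P ->
  carries P m.+2 a -> carries P m.+2 c -> carries P m.+2 d ->
  carries P m.+2 (a * c) -> carries P m.+2 (a * d) -> carries P m.+2 (c * d) ->
  carries P m.+2 (a * (c * d) + a * (d * c)).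
Proof.
move=> Ps LP Pa Pc Pd Pac Pad Pcd.
have Ts := subspace_carries m.+2 Ps; have L2T := carries_L2 LP.
have L2c u v : carries P m.+2 (lie u v) by exact: (L2T _ (L2_lie u v)).
have Pca := mul_swap Ts L2T Pac.
have Pda := mul_swap Ts L2T Pad.
have Pdc := mul_swap Ts L2T Pcd.
apply: (subspace_divn (k := 2) charF0 Ts).
(* Modulo commutators a product may be rotated cyclically, so three times the element is the full
   symmetrization of a c d, the polarized cube. *)
rewrite (_ : _ *+ 3 =
  (a * c * d + a * d * c + c * a * d + c * d * a + d * a * c + d * c * a) +
  (lie a (c * d) + lie (a * c) d + lie a (d * c) + lie (a * d) c)); last by ncring.
apply: (subspaceD Ts); last first.
  by lincomb Ts; exact: L2c.
set w := (X in carries _ _ X).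
suff: L m.+2 `<=` [set g | P (lie w g)] by [].
apply: L_sub_lie => [|b l Ll /=]; first exact: subspace_lie.
rewrite {}/w; apply: (subspace_divn (k := 1) charF0 Ps).
pose l0 q r := - lie (q * r * b) l - lie (q * b) (lie r l).
pose l1 r := lie (r * b) l *+ 2 + lie b (lie r l).
(* With equal arguments the identity below is a multiple of 2 [a^3, y] = [a, [G a a]] + [a^2,
   [H a]], y = [b, l]. It follows from y a = a y - [a, y], a^2 y = [l0 a a] + a [l1 a] and 2 a
   [a, z] = [a^2, z] + [a, [a, z]]. *)
pose G q r := l0 q r *+ 6 + lie q (l1 r) *+ 3 - lie q (lie r (lie b l)).
pose H r := (l1 r - lie r (lie b l)) *+ 3.
rewrite (_ : _ *+ 2 =
  lie a (G c d + G d c) + lie c (G a d + G d a) + lie d (G c a + G a c) +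
  (lie (a * c + c * a) (H d) + lie (a * d + d * a) (H c) +
   lie (d * c + c * d) (H a))); last by rewrite /G /H /l0 /l1; ncring.
have L1 u v : L m.+2 (lie u (lie v l)) by apply/LS_sub; do 2!apply: lie_LS.
have L0 u : L m.+2 (lie u l) by exact: lie_LS.
have Ll1 r : L m.+2 (l1 r) by rewrite /l1; lincomb (subspace_L m.+2).
have LG q r : L m.+2 (G q r).
  rewrite /G /l0; lincomb (subspace_L m.+2) => //.
  - exact/LS_sub/lie_LS.
  - exact/LS_sub/lie_LS.
have LH r : L m.+2 (H r) by rewrite /H; lincomb (subspace_L m.+2).
clearbody G H; rewrite !(lieDl, lieDr); lincomb Ps; first
  [exact: Pa | exact: Pc | exact: Pd | exact: Pac | exact: Pad | exact: Pcd
  | exact: Pca | exact: Pda | exact: Pdc].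
Qed.

(** Induction on length. The last hypothesis gives a b c = - a c b modulo [T]. For length at least
    4, cycling b, c, d in a b c d takes three such steps and returns the word with a minus sign, so
    twice the word is in [T]. For length 3 no such cycle is available, whence the hypothesis on x_i
    [x_j, x_k]. *)
Lemma words_closed n (g : 'I_n -> A) T : subspace T -> T 1 ->
  (forall i, T (g i)) -> (forall i j, T (g i * g j)) ->
  (forall i j k, T (g i * lie (g j) (g k))) ->
  (forall a b c, T a -> T b -> T c -> T (a * b) -> T (a * c) -> T (b * c) ->
     T (a * (b * c) + a * (c * b))) ->
  forall s, T (word g s).
Proof.
move=> Ts T1 Tg Tgg Tglie T3 s; have [N] := ubnP (size s).
elim: N s => // N IHN [|i [|j [|k [|e s]]]] /=; rewrite ?ltnS => le_s.
- by rewrite /word big_nil.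
- by rewrite word1.
- by rewrite word2.
- rewrite word_cons word2; apply: (subspace_divn (k := 1) charF0 Ts).
  rewrite (_ : _ *+ 2 = (g i * (g j * g k) + g i * (g k * g j)) +
    g i * lie (g j) (g k)); last by ncring.
  by apply: subspaceD => //; exact: T3.
set t := e :: s; have le_t : ((size t).+2 < N)%N by [].
have Tw r : (size r <= (size t).+2)%N -> T (word g r).
  by move=> le_r; apply: IHN; lia.
have mul4 a b c d : T (a * (b * (c * d)) + a * ((c * d) * b)) ->
    T (a * (c * (d * b)) + a * ((d * b) * c)) ->
    T (a * (d * (b * c)) + a * ((b * c) * d)) -> T (a * (b * (c * d))).
  move=> T1' T2' T3'; apply: (subspace_divn (k := 1) charF0 Ts).
  rewrite (_ : _ *+ 2 = (a * (b * (c * d)) + a * ((c * d) * b)) -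
    (a * (c * (d * b)) + a * ((d * b) * c)) +
    (a * (d * (b * c)) + a * ((b * c) * d))); last by ncring.
  by apply: (subspaceD Ts) => //; exact: subspaceB.
rewrite 3!word_cons -!(word1 g).
by apply: mul4; apply: T3; rewrite -?word_cat; apply: Tw; rewrite ?size_cat /=; lia.
Qed.

Lemma mul_lie_swap23 a b c : a * lie b c = - (a * lie c b).
Proof. by rewrite lieC mulrN. Qed.

(** Modulo commutators, a b c - a c b is invariant under rotation and so changes sign under every
    transposition. *)
Lemma mul_lie_swap12 a b c :
  a * lie b c = - (b * lie a c) + (lie (a * b) c - lie (lie a c) b).
Proof. by ncring. Qed.

Lemma mul_lie_alternating n (g : 'I_n -> A) T : subspace T -> L 2 `<=` T ->
  (forall i j k : 'I_n, (i < j)%N -> (j < k)%N -> T (g i * lie (g j) (g k))) ->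
  forall i j k, T (g i * lie (g j) (g k)).
Proof.
move=> Ts L2T Tlt i j k.
have s23 a b c : T (a * lie b c) -> T (a * lie c b).
  by rewrite mul_lie_swap23 => ?; rewrite -[_ * _]opprK; exact: subspaceN.
have s12 a b c : T (a * lie b c) -> T (b * lie a c).
  move=> Tabc; rewrite mul_lie_swap12; apply: subspaceD => //; first exact: subspaceN.
  by apply: subspaceB => //; apply: L2T; exact: L2_lie.
have Taab a b : T (a * lie a b).
  by rewrite (_ : _ * _ = lie a (a * b)); [exact/L2T/L2_lie | ncring].
have [ij|ji|/val_inj ->//] := ltngtP i j; have [jk|kj|/val_inj->] := ltngtP j k;
  have [ik|ki|/val_inj ik] := ltngtP i k; subst=> //;
  try (exfalso; lia); try exact/s23/Taab; try exact/s12/s23/Taab;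
  by first [exact: Tlt | exact/s23/Tlt | exact/s12/Tlt | exact/s12/s23/Tlt
    | exact/s23/s12/Tlt | exact/s12/s23/s12/Tlt].
Qed.

(** Criterion behind all cases with m at least 2. The index [m.+2] ensures that the elements
    bracketed in [carries_mul3] are spanned by commutators. *)
Lemma L_sub_of_carries n (g : 'I_n -> A) m P : words_span g ->
  subspace P -> L m.+4 `<=` P ->
  (forall i, carries P m.+2 (g i)) ->
  (forall i j : 'I_n, (i <= j)%N -> carries P m.+2 (g i * g j)) ->
  (forall i j k : 'I_n, (i < j)%N -> (j < k)%N ->
     carries P m.+2 (g i * lie (g j) (g k))) ->
  L m.+3 `<=` P.
Proof.
move=> gA Ps LP cg cgg cglie; apply: carries_full => //.
have Ts := subspace_carries m.+2 Ps; have L2T := carries_L2 LP.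
apply: gA => //; apply: words_closed => //.
- by move=> l _; rewrite (_ : lie 1 l = 0); [exact: subspace0 | ncring].
- move=> i j; case: (leqP i j) => [|/ltnW] /cgg //; exact: mul_swap.
- exact: mul_lie_alternating.
- by move=> *; exact: carries_mul3.
Qed.

(** Letters are peeled off a word by [x w, l] = [x, w l] + [w, l x]. *)
Lemma L2_sub n (g : 'I_n -> A) P : words_span g -> subspace P ->
  (forall i u, P (lie (g i) u)) -> L 2 `<=` P.
Proof.
move=> gA Ps Pg; apply: carries_full => //; apply: gA => [|s l _].
  exact: subspace_carries.
elim: s l => [|i s IHs] l.
  by rewrite /word big_nil (_ : lie 1 l = 0); [exact: subspace0 | ncring].
rewrite word_cons (_ : lie _ l = lie (g i) (word g s * l) + lie (word g s) (l * g i)).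
  exact: subspaceD.
by ncring.
Qed.

(** * Squares of generators in the case of two variables *)

(** The conclusions say that a, b and a b carry [L m.+1] into the space of those l with [a^2, l] in
    [P]. These are the hypotheses for an induction on m proving that a^2 carries [L m.+2] into
    [P]. *)
Lemma carries_square P m a b : subspace P -> L m.+4 `<=` P ->
  carries P m.+2 a -> carries P m.+2 b -> carries P m.+2 (a * b) ->
  forall l, L m.+1 l -> [/\ P (lie (a * a) (lie a l)),
    P (lie (a * a) (lie b l)) & P (lie (a * a) (lie (a * b) l))].
Proof.
move=> Ps LP Pa Pb Pab; have LL k := subspace_L k.
have Ts := subspace_carries m.+2 Ps; have L2T := carries_L2 LP.
have Pba : carries P m.+2 (b * a) := mul_swap Ts L2T Pab.
have PL3 w l : L 3 w -> L m.+1 l -> P (lie w l).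
  by move=> Lw Ll; apply/LP/(lie_L Lw Ll).
have L3c u v w : L 3 (lie u (lie v w)) by do 2!apply: lie_LS.
have Paal l : L m.+1 l -> P (lie (a * a) (lie a l)).
  move=> Ll; rewrite (_ : lie _ _ = lie a (lie (a * a) l)); last by ncring.
  exact/Pa/lie_LS.
have Pabl l : L m.+1 l -> P (lie (a * a) (lie b l)).
  (* Jacobi identity together with [a^2, b] = [a, a b] + [a, b a]. *)
  move=> Ll; rewrite (_ : lie _ _ =
    lie b (lie (a * a) l) + (lie a (lie (a * b) l) - lie (a * b) (lie a l)) +
    (lie a (lie (b * a) l) - lie (b * a) (lie a l))); last by ncring.
  have La u : L m.+2 (lie u l) by exact: lie_LS.
  by lincomb Ps; first [exact: Pb | exact: Pa | exact: Pab | exact: Pba].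
move=> l Ll; split; [exact: Paal | exact: Pabl |].
have La u : L m.+2 (lie u l) by exact: lie_LS.
have Lb u v : L m.+2 (lie u (lie v l)) by exact/LS_sub/lie_LS.
have Lc u v w : L m.+2 (lie u (lie v (lie w l))) by exact/LS_sub/lie_LS.
apply: (subspace_divn (k := 2) charF0 Ps); rewrite -[_ *+ 3]opprK.
apply: subspaceN => //.
(* As 3 [a^2, a b] = 2 [a^3, b] modulo L 3, we have
   3 [a^2, [a b, l]] = 2 [a^3, [b, l]] modulo P, whereas expanding
   2 [a^3, [b, l]] as in carries_mul3 gives 6 [a^2, [a b, l]] modulo P. *)
rewrite (_ : - _ =
  lie a ((- lie (a * a * b) l - lie (a * b) (lie a l)) *+ 6 +
         (lie a (lie (a * b) l) *+ 2 + lie a (lie b (lie a l))) *+ 3 -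
         lie a (lie a (lie b l))) +
  (lie (a * a) (lie b (lie a l)) - lie (a * a) (lie a (lie b l))) *+ 3 +
  (lie (a * b) (lie (a * a) l) *+ 3 - lie b (lie (a * a * a) l) *+ 2) +
  lie (lie (a * a) (lie a b) + lie a (lie a (b * a))) l); last by ncring.
have Lal u : L m.+1 (lie u l) by exact/LS_sub.
rewrite (lieDl _ _ l); lincomb Ps; first [exact: PL3 | exact: Pab | exact: Pb
  | exact: Pabl | exact: Paal | idtac].
by apply: Pa; lincomb (LL m.+2).
Qed.

(** Induction on m, starting from [L2_sub]. The induction hypothesis, applied to the space of those
    l with [x_i^2, l] in [P], supplies the squares missing from [L_sub_of_carries]; two indices
    leave no triple i < j < k. *)
Lemma L_sub_of_carries2 n (g : 'I_n -> A) i j m P : words_span g ->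
  (forall k, k = i \/ k = j) -> subspace P -> L m.+3 `<=` P ->
  (forall k, carries P m.+1 (g k)) -> carries P m.+1 (g i * g j) ->
  L m.+2 `<=` P.
Proof.
move=> gA; elim: m => [|m IHm] in P i j * => ij Ps LP cg cgij.
  by apply: (L2_sub gA Ps) => k u; exact: cg.
have sq i' j' : (forall k, k = i' \/ k = j') ->
    carries P m.+2 (g i' * g j') -> carries P m.+2 (g i' * g i').
  move=> ij' cij; have sqP := carries_square Ps LP (cg i') (cg j') cij.
  suff: L m.+2 `<=` [set l | P (lie (g i' * g i') l)] by [].
  apply: (IHm _ i' j') => //; first exact: subspace_lie.
  - by move=> l Ll; exact/LP/lie_LS.
  - by move=> k l /sqP[Pi Pj _]; case: (ij' k) => ->.
  - by move=> l /sqP[].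
have Ts := subspace_carries m.+2 Ps; have L2T := carries_L2 LP.
have cgji := mul_swap Ts L2T cgij.
apply: (L_sub_of_carries gA Ps LP cg) => [i' j' _|i' j' k' lt_ij lt_jk].
  case: (ij i') (ij j') => -> [] -> //; first exact: sq cgij.
  by apply: sq cgji => k; case: (ij k); [right | left].
exfalso; case: (ij i') (ij j') (ij k') lt_ij lt_jk => -> [] -> [] ->; lia.
Qed.

(** * Centrality of x_1 [x_2, x_3] in the case of three variables *)

(** Modulo [L 3], [t, a^(p+2)] = [a t, a^(p+1)] + [a^(p+1) t, a]; iterating splits off all the
    factors a. *)
Lemma lie_pow_L3 a t p : L 3 (lie t (a ^+ p.+1) - lie (a ^+ p * t) a *+ p.+1).
Proof.
elim: p t => [|p IHp] t.
  by rewrite expr0 mul1r expr1 mulr1n subrr; exact: L_0.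
rewrite (_ : _ - _ = (lie (a * t) (a ^+ p.+1) - lie (a ^+ p * (a * t)) a *+ p.+1) +
  lie (lie t (a ^+ p.+1)) a).
  by apply: L_D => //; apply: L3_lie_l; exact: L2_lie.
rewrite mulrA -exprSr [X in _ - X]mulrSr [in lie t _]exprSr.
move: (a ^+ p.+1) => y; move: (_ *+ p.+1) => z.
by ncring.
Qed.

(** Both brackets are nonzero integer multiples of [a^(p+1) t, a] modulo [L 3]. This absorbs a left
    factor a into the power. *)
Lemma L3_lie_mul_pow a t p :
  L 3 (lie t (a ^+ p.+2)) -> L 3 (lie (a * t) (a ^+ p.+1)).
Proof.
move=> Lt; have L3s := subspace_L 3.
have La : L 3 (lie (a ^+ p.+1 * t) a).
  apply: (subspace_divn (k := p.+1) charF0 L3s).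
  rewrite -[_ *+ _](subKr (lie t (a ^+ p.+2))).
  by apply: L_B => //; exact: lie_pow_L3.
rewrite -[lie _ _](subrK (lie (a ^+ p * (a * t)) a *+ p.+1)).
apply: L_D; first exact: lie_pow_L3.
by rewrite mulrA -exprSr; exact: subspaceMn.
Qed.

(* [a [b, c], d] is alternating in a, b, c, d modulo L 3. *)
Lemma L3_swap12 a b c d : L 3 (lie (a * lie b c) d) -> L 3 (lie (b * lie a c) d).
Proof.
move=> Labc; rewrite (_ : lie _ _ = - lie (a * lie b c) d +
  (lie (lie (b * a) c) d - lie (lie (lie b c) a) d)); last by ncring.
by lincomb (subspace_L 3) => //; apply: L3_lie_l; exact: L2_lie.
Qed.

Lemma L3_swap23 a b c d : L 3 (lie (a * lie b c) d) -> L 3 (lie (a * lie c b) d).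
Proof.
move=> Labc; rewrite (_ : lie _ _ = - lie (a * lie b c) d); last by ncring.
by apply: (subspaceN (subspace_L 3)).
Qed.

Lemma L3_swap34 a b c d : L 3 (lie (a * lie b c) d) -> L 3 (lie (a * lie b d) c).
Proof.
(* The sum of the two brackets comes from [a, [b, c d]], expanded by the Leibniz rule in c d. *)
move=> Labc; rewrite (_ : lie _ _ = - lie (a * lie b c) d +
  (- lie (lie b (c * d)) a + lie (lie c (lie b d)) a -
   lie (d * a) (lie b c) - lie (c * a) (lie b d))); last by ncring.
by lincomb (subspace_L 3) => //; first [apply: L3_lie_l; exact: L2_lie
  | apply: lie_LS; exact: L2_lie].
Qed.

Lemma L3_rot a b c d : L 3 (lie (a * lie b c) d) -> L 3 (lie (a * lie c d) b).
Proof. by move/L3_swap34/L3_swap23/L3_swap34/L3_swap23. Qed.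

(** The statement is strengthened to [v [x_i^p, x_j^q], x_k^r] for all v and all positive exponents.
    For a word v, rotation brings the power of its first letter to the last slot, where
    [L3_lie_mul_pow] absorbs that letter by raising the exponent. Finally v is moved to the last
    slot by alternation. *)
Lemma L3_mul_lie n (g : 'I_n -> A) i j k : words_span g ->
  (forall h, [\/ h = i, h = j | h = k]) ->
  forall u, L 3 (lie (g i * lie (g j) (g k)) u).
Proof.
move=> gA ijk u; pose T := [set v | forall p q r,
  L 3 (lie (v * lie (g i ^+ p.+1) (g j ^+ q.+1)) (g k ^+ r.+1))].
have Tu : T u.
  apply: gA => [|s]; first split=> [p q r|c v w Tv Tw p q r].
  - by rewrite mul0r lie0l; exact: L_0.
  - by rewrite mulrDl -scalerAl lieDl lieZl; apply: L_D; [exact: L_Z|].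
  elim: s => [|h s IHs] p q r.
    by rewrite /word big_nil mul1r; apply: L3_lie_l; exact: L2_lie.
  rewrite word_cons; case: (ijk h) => ->.
  - do 2!apply: L3_rot; rewrite -mulrA; apply: L3_lie_mul_pow.
    by apply: L3_rot; exact: IHs.
  - apply: L3_rot; rewrite -mulrA; apply: L3_lie_mul_pow.
    by do 2!apply: L3_rot; exact: IHs.
  - by rewrite -mulrA; apply: L3_lie_mul_pow; exact: IHs.
have := Tu 0 0 0; rewrite !expr1.
by move/L3_swap12/L3_rot.
Qed.

(** The graded Lie algebra is generated by [B 1], so by the Jacobi identity commuting with [B 1]
    suffices. The target is [L m.+3], one step beyond the automatic [L m.+2]. *)
Lemma lie_central m z l : (forall u, L 3 (lie z u)) -> L m.+1 l ->
  L m.+3 (lie z l).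
Proof.
move=> Lz; elim: m l => [l _|m IHm]; first exact: Lz.
apply: (L_sub_lie (T := [set l | L m.+4 (lie z l)])) => [|a l Ll].
  exact/subspace_lie/subspace_L.
have : L m.+4 (lie (lie z a) l + lie a (lie z l)).
  by apply: L_D; [exact: (lie_L (Lz a) Ll) | apply: lie_LS; exact: IHm].
by rewrite (_ : _ + _ = lie z (lie a l)); last ncring.
Qed.

End LowerCentral.

(** * Passage between [L m] and the quotients [B m] *)

Section Graded.
Variables (F : fieldType) (A : algType F).

(* The preimage of S under L m -> B m. *)
Definition lifts m (S : set (B A m)) : set A :=
  [set v | exists2 u : Lspace A m, val u = v & S (cls u)].

Lemma subspace_lifts m (S : set (B A m)) : subspace S -> subspace (lifts S).
Proof.
move=> Ss; split=> [|c _ _ [u <- Su] [v <- Sv]].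
  by exists 0; [exact: raddf0 | rewrite raddf0; exact: subspace0].
exists (c *: u + v); first exact: linearP.
by rewrite linearP; apply: (subspaceD Ss) => //; exact: subspaceZ.
Qed.

Lemma lifts_L m (S : set (B A m)) : subspace S -> L m.+1 `<=` lifts S.
Proof.
move=> Ss v Lv; exists (InL (introT (LpredP m v) (LS_sub Lv))) => //.
rewrite (_ : cls _ = 0); first exact: subspace0.
rewrite -(raddf0 (@cls F A m)); apply/clsP.
by rewrite (_ : _ - _ = v) //; rewrite [val 0](raddf0 val) subr0.
Qed.

(** Turns the summands of a right-hand side into hypotheses of the criteria above. *)
Lemma carries_lifts m (S : set (B A m.+1)) a : brB a m `<=` S ->
  carries (lifts S) m a.
Proof.
move=> aS l Ll; pose u := InL (introT (LpredP m l) Ll).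
pose a1 := InL (introT (LpredP 1 a) I).
exists (Llie a1 u : Lspace A m.+1) => //.
by apply: aS; exists (cls u) => //; rewrite Blie_cls.
Qed.

Lemma setT_lifts m (S : set (B A m)) : L m `<=` lifts S -> [set: B A m] = S.
Proof.
move=> LS; apply/seteqP; split=> // x _; rewrite -[x]cls_repr.
by have /LpredP/LS[u /val_inj <-] := Lval_in (repr x).
Qed.

Lemma subspace_brB a m : subspace (@brB F A a m).
Proof.
pose a1 := InL (introT (LpredP 1 a) I).
have aE (u : Lspace A m) : Blie (bar a) (cls u) = cls (Llie a1 u) by exact: Blie_cls.
split=> [|c _ _ [x _ <-] [y _ <-]].
  exists (cls 0) => //; rewrite aE (_ : Llie _ _ = 0); first exact: raddf0.
  by apply: val_inj; rewrite /= /lie mulr0 mul0r subrr.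
exists (c *: x + y) => //; rewrite -[x]cls_repr -[y]cls_repr -linearP !aE -linearP.
congr cls; apply: val_inj; rewrite linearP /=.
by rewrite lieDr lieZr.
Qed.

End Graded.

(** * Words as the monomial basis of the free algebra *)

Section FreeAlgebra.
Variables (F : fieldType) (n : nat).

Lemma word_gen (s : seq 'I_n) : word (gen F) s = << FMonom s >>.
Proof.
elim: s => [|i s IHs].
  by rewrite /word big_nil -fmoneE.
rewrite word_cons IHs /gen.
rewrite [LHS](_ : _ = << 1 * 1 *g fmmul (fmu i) (FMonom s) >>).
  by rewrite mulr1 fmmulE fmuE.
exact: fgmulUU.
Qed.

Lemma words_span_gen : words_span (@gen F n).
Proof.
move=> T Ts Tw u; rewrite [u]monalgE.
apply: (big_ind T) => [||k _]; first exact: subspace0.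
  by move=> v w; exact: subspaceD.
rewrite (_ : << _ *g _ >> = u@_k *: << k >>).
  apply: (subspaceZ _ Ts); rewrite -(fmK k) -word_gen; exact: Tw.
by apply/malgP => k'; rewrite mcoeffZ !mcoeffU mulr_natr.
Qed.

End FreeAlgebra.

(** * Generation of [B m.+1] from [B m], according to the number of variables *)

Theorem theorem1p3 (F : fieldType) (charF0 : [pchar F] =i pred0)
    (n : nat) (n_ge2 : (2 <= n)%N) (m : nat) (m_ge2 : (2 <= m)%N) :
  let x : 'I_n -> freeAlg F n := gen F in
  [/\ [set: B (freeAlg F n) 2%N] =
        \big[addset/[set 0]]_(i < n) brB (x i) 1%N,
      (4 <= n)%N ->
        [set: B (freeAlg F n) m.+1] =
        addset
          (addset
            (\big[addset/[set 0]]_(i < n) brB (x i) m)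
            (\big[addset/[set 0]]_(i < n)
               \big[addset/[set 0]]_(j < n | (i <= j)%N) brB (x i * x j) m))
          (\big[addset/[set 0]]_(i < n)
             \big[addset/[set 0]]_(j < n | (i < j)%N)
               \big[addset/[set 0]]_(k < n | (j < k)%N)
                 brB (x i * lie (x j) (x k)) m),
      n = 3%N ->
        [set: B (freeAlg F n) m.+1] =
        addset
          (\big[addset/[set 0]]_(i < n) brB (x i) m)
          (\big[addset/[set 0]]_(i < n)
             \big[addset/[set 0]]_(j < n | (i <= j)%N) brB (x i * x j) m)
    & n = 2%N ->
        [set: B (freeAlg F n) m.+1] =
        addset
          (\big[addset/[set 0]]_(i < n) brB (x i) m)
          (\big[addset/[set 0]]_(i < n)
             \big[addset/[set 0]]_(j < n | (i < j)%N) brB (x i * x j) m)].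
Proof.
case: m m_ge2 => [|[|m]] // _ x; have xA := @words_span_gen F n.
have yS y : subspace (brB y m.+2) := subspace_brB y m.+2.
pose S1 := \big[addset/[set 0]]_(i < n) brB (x i) m.+2.
pose S2 := \big[addset/[set 0]]_(i < n)
  \big[addset/[set 0]]_(j < n | (i <= j)%N) brB (x i * x j) m.+2.
pose S2' := \big[addset/[set 0]]_(i < n)
  \big[addset/[set 0]]_(j < n | (i < j)%N) brB (x i * x j) m.+2.
pose S3 := \big[addset/[set 0]]_(i < n) \big[addset/[set 0]]_(j < n | (i < j)%N)
  \big[addset/[set 0]]_(k < n | (j < k)%N) brB (x i * lie (x j) (x k)) m.+2.
have S1s : subspace S1 by apply: subspace_bigaddset => i; exact: yS.
have S2s : subspace S2 by do 2!apply: subspace_bigaddset => ?; exact: yS.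
have S2's : subspace S2' by do 2!apply: subspace_bigaddset => ?; exact: yS.
have S3s : subspace S3 by do 3!apply: subspace_bigaddset => ?; exact: yS.
have xS1 i : brB (x i) m.+2 `<=` S1.
  by apply: (sub_bigaddset (S := fun i => brB (x i) m.+2)) => // k; exact: yS.
have xS2 (i j : 'I_n) : (i <= j)%N -> brB (x i * x j) m.+2 `<=` S2.
  apply: (sub_bigaddset2 (P := fun i j : 'I_n => (i <= j)%N)
    (S := fun i j => brB (x i * x j) m.+2)) => *; exact: yS.
have xS2' (i j : 'I_n) : (i < j)%N -> brB (x i * x j) m.+2 `<=` S2'.
  apply: (sub_bigaddset2 (P := fun i j : 'I_n => (i < j)%N)
    (S := fun i j => brB (x i * x j) m.+2)) => *; exact: yS.
have xS3 (i j k : 'I_n) : (i < j)%N -> (j < k)%N ->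
    brB (x i * lie (x j) (x k)) m.+2 `<=` S3.
  move=> lt_ij lt_jk.
  apply: subset_trans (sub_bigaddset (P := fun k : 'I_n => (j < k)%N)
    (S := fun k => brB (x i * lie (x j) (x k)) m.+2) _ lt_jk) _ => [h|].
    exact: yS.
  apply: (sub_bigaddset2 (P := fun i j : 'I_n => (i < j)%N)
    (S := fun i j => \big[addset/[set 0]]_(k < n | (j < k)%N)
       brB (x i * lie (x j) (x k)) m.+2)) => // *.
  by apply: subspace_bigaddset => ?; exact: yS.
have S12s := subspace_addset S1s S2s.
have S12's := subspace_addset S1s S2's.
split=> [|n_ge4|n3|n2].
- set S := \big[_/_]_(_ | _) _.
  have Ss : subspace S by apply: subspace_bigaddset => i; exact: subspace_brB.
  apply/setT_lifts/(L2_sub xA (subspace_lifts Ss)) => i u.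
  apply: (@carries_lifts _ _ 1 _ (x i)) => //.
  by apply: (sub_bigaddset (S := fun i => brB (x i) 1)) => // k; exact: subspace_brB.
- have Ss := subspace_addset S12s S3s.
  apply/setT_lifts/(L_sub_of_carries charF0 xA (subspace_lifts Ss)).
  + exact: lifts_L.
  + move=> i; apply: carries_lifts; apply: subset_trans (xS1 i) _.
    exact: subset_trans (sub_addsetl S2s) (sub_addsetl S3s).
  + move=> i j le_ij; apply: carries_lifts; apply: subset_trans (xS2 i j le_ij) _.
    exact: subset_trans (sub_addsetr S1s) (sub_addsetl S3s).
  + move=> i j k lt_ij lt_jk; apply: carries_lifts.
    exact: subset_trans (xS3 i j k lt_ij lt_jk) (sub_addsetr S12s).
- apply/setT_lifts/(L_sub_of_carries charF0 xA (subspace_lifts S12s)).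
  + exact: lifts_L.
  + move=> i; apply: carries_lifts; exact: subset_trans (xS1 i) (sub_addsetl S2s).
  + move=> i j le_ij; apply: carries_lifts.
    exact: subset_trans (xS2 i j le_ij) (sub_addsetr S1s).
  (* By centrality the bracket with x_i [x_j, x_k] vanishes in the quotient, so no third summand is
     needed to contain it. *)
  + move=> i j k lt_ij lt_jk l Ll; apply: lifts_L => //.
    apply: lie_central Ll; apply: (L3_mul_lie charF0 xA) => h.
    (* For n = 3 the inequalities i < j < k exhaust the indices. *)
    have [|hi] := eqVneq h i; first by constructor 1.
    have [|hj] := eqVneq h j; first by constructor 2.
    constructor 3; apply: val_inj; move: hi hj (ltn_ord h) (ltn_ord k).
    by rewrite -!val_eqE /=; lia.
- subst n.
  have ij2 (k : 'I_2) : k = ord0 \/ k = ord_max.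
    by case: k => [[|[|k]] lt_k] //; [left | right]; exact: val_inj.
  apply/setT_lifts/(L_sub_of_carries2 charF0 xA ij2 (subspace_lifts S12's)).
  + exact: lifts_L.
  + move=> k; apply: carries_lifts; exact: subset_trans (xS1 k) (sub_addsetl S2's).
  + apply: carries_lifts.
    exact: subset_trans (xS2' ord0 ord_max isT) (sub_addsetr S1s).
Qed.
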